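(* Let $f\in S[G]$ be a nonzero $\sigma$-polynomial. Then $\mathrm{rk}_{\mathrm{inn}}(f,R)\ge n-\deg_\sigma(f)$.
   Context: Setting: $G=\langle\sigma\rangle$ is a cyclic group of order $n$. A $G$-Galois extension is an extension $S/R$ of commutative rings such that $G$ is a subgroup of $\mathrm{Aut}(S/R)$ (automorphisms of $S$ as $R$-algebra), $S^G=R$, and the map $S\otimes_R S\to\bigoplus_{g\in G}S$, $x\otimes y\mapsto (xg(y))_{g\in G}$, is bijective. $S/R$ is an unramified $G$-Galois extension of local principal ideal rings, meaning: there is a $G$-Galois extension $\tilde S/\tilde R$ of discrete valuation rings and $\omega\in\tilde R$ such that $\tilde R\omega$ and $\tilde S\omega$ are the maximal ideals of $\tilde R$ and $\tilde S$, and either $R=\tilde R$, $S=\tilde S$, or $R=\tilde R/\tilde R\omega^k$, $S=\tilde S/\tilde S\omega^k$ for some $k\geq 1$, with $G$ acting on $S$ by the induced automorphisms; then $S/R$ is $G$-Galois and $S$ is a free $R$-module of rank $n$. $S[G]$ is the skew group algebra: the free $S$-module with basis $G$ and multiplication $(ag)(bh)=a\,g(b)\,gh$. It is identified with $\mathrm{End}_R(S)$ via $\sum_g a_g g\mapsto (x\mapsto\sum_g a_g g(x))$. Its elements, written as $\sum_{i=0}^{n-1}a_i\sigma^i$ with $a_i\in S$, are called $\sigma$-polynomials; $\deg_\sigma$ of a nonzero $\sigma$-polynomial is the largest $i$ with $a_i\ne0$. For a finitely generated $R$-module $M$, the inner rank $\mathrm{rk}_{\mathrm{inn}}(M,R)$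 is the minimal number of generators of $M$ as an $R$-module; for $f\in S[G]$ viewed in $\mathrm{End}_R(S)$, $\mathrm{rk}_{\mathrm{inn}}(f,R)=\mathrm{rk}_{\mathrm{inn}}(f(S),R)$. *)

(* Defs.v *)
From HB Require Import structures.
From mathcomp Require Import all_boot all_fingroup all_algebra.
From mathcomp Require Import generic_quotient boolp classical_sets.

Set Implicit Arguments.
Unset Strict Implicit.
Unset Printing Implicit Defensive.

Import GRing.Theory.
Local Open Scope ring_scope.
Local Open Scope quotient_scope.

(** * Tensor products over a commutative ring *)

Section Tensor.
Variables (R : comNzRingType) (M N : lmodType R).

(* A sequence of pairs stands for the formal sum of the corresponding pure
   tensors. *)
Inductive tensor_rel : seq (M * N) -> seq (M * N) -> Prop :=
| tensor_refl s : tensor_rel s s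
| tensor_sym s t : tensor_rel s t -> tensor_rel t s
| tensor_trans s t u : tensor_rel s t -> tensor_rel t u -> tensor_rel s u
| tensor_cat s s' t t' :
    tensor_rel s s' -> tensor_rel t t' -> tensor_rel (s ++ t) (s' ++ t')
| tensor_catC s t : tensor_rel (s ++ t) (t ++ s)
| tensor_zero y : tensor_rel [:: (0, y)] [::]
| tensor_addl x x' y : tensor_rel [:: (x + x', y)] [:: (x, y); (x', y)]
| tensor_addr x y y' : tensor_rel [:: (x, y + y')] [:: (x, y); (x, y')]
| tensor_scale a x y : tensor_rel [:: (a *: x, y)] [:: (x, a *: y)].

Definition tensor_relb : rel (seq (M * N)) := fun s t => `[< tensor_rel s t >].

Lemma tensor_relb_refl : reflexive tensor_relb.
Proof. by move=> s; apply/asboolP; exact: tensor_refl. Qed.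

Lemma tensor_relb_sym : symmetric tensor_relb.
Proof. by move=> s t; apply/asboolP/asboolP; exact: tensor_sym. Qed.

Lemma tensor_relb_trans : transitive tensor_relb.
Proof.
move=> t s u /asboolP st /asboolP tu.
by apply/asboolP; exact: tensor_trans st tu.
Qed.

Canonical tensor_equiv :=
  EquivRel tensor_relb tensor_relb_refl tensor_relb_sym tensor_relb_trans.

Definition tensor := {eq_quot tensor_equiv}.

End Tensor.

(** * Galois extensions of commutative rings *)

Record algAction (gT : finGroupType) (R : comNzRingType) (S : comAlgType R) :=
  AlgAction {
    act :> gT -> {lrmorphism S -> S};
    act1E : forall x, act 1%g x = x;
    actME : forall g h x, act (g * h)%g x = act g (act h x) }.

Section Galois.
Variables (gT : finGroupType) (R : comNzRingType) (S : comAlgType R).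
Variable A : algAction gT S.

Definition galois_sum (s : seq (S * S)) : {ffun gT -> S} :=
  [ffun g => \sum_(p <- s) p.1 * A g p.2].

Definition galois_map (t : tensor S S) : {ffun gT -> S} := galois_sum (repr t).

Lemma galois_sum_rel (s t : seq (S * S)) :
  tensor_rel s t -> galois_sum s = galois_sum t.
Proof.
elim=> {s t} [//|s t _ ->//|s t u _ -> _ ->//|s s' t t' _ + _|s t|y|x x' y|x y y'|a x y].
- move=> /ffunP e1 /ffunP e2; apply/ffunP=> g.
  by move: (e1 g) (e2 g); rewrite !ffunE !big_cat /= => -> ->.
- by apply/ffunP=> g; rewrite !ffunE !big_cat /= addrC.
- by apply/ffunP=> g; rewrite !ffunE big_seq1 big_nil mul0r.
- by apply/ffunP=> g; rewrite !ffunE !big_cons big_nil !addr0 mulrDl.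
- by apply/ffunP=> g; rewrite !ffunE !big_cons big_nil !addr0 /= rmorphD mulrDr.
- by apply/ffunP=> g; rewrite !ffunE !big_seq1 /= linearZ -scalerAl -scalerAr.
Qed.

(* [galois_map] is the additive map with x (x) y |-> (x g(y))_g. *)
Lemma galois_mapE (s : seq (S * S)) :
  galois_map (\pi_(tensor S S) s) = galois_sum s.
Proof.
apply: galois_sum_rel; apply/asboolP.
by have /eqmodP := reprK (\pi_(tensor S S) s).
Qed.

Definition is_galois : Prop :=
  [/\ (* R is a subring of S *)
      injective (fun r : R => r%:A : S),
      (* G is a subgroup of Aut(S/R) *)
      forall g, (forall x, A g x = x) -> g = 1%g,
      (* S^G = R *)
      forall x, (forall g, A g x = x) -> exists r : R, x = r%:A
    & bijective galois_map].

End Galois.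

(** * Discrete valuation rings, unramified extensions *)

Section Ideals.
Variable A : comNzRingType.

Definition principal (w : A) : {pred A} :=
  [pred x | `[< exists y, x = y * w >]].

(* [idealr_closed] only holds of proper ideals. *)
Definition is_maximal (I : {pred A}) : Prop :=
  idealr_closed I /\
  forall J : {pred A}, idealr_closed J -> {subset I <= J} -> J =i I.

Definition is_dvr : Prop :=
  [/\ GRing.integral_domain_axiom A,
      forall I : {pred A}, idealr_closed I -> exists w, I =i principal w
    & exists m : {pred A},
        [/\ is_maximal m, exists2 x, x \in m & x != 0
          & forall m', is_maximal m' -> m' =i m]].

End Ideals.

(* "R = R~ / R~ w^k" is expressed by a surjective morphism R~ -> R with kernel
   R~ w^k, and "R = R~" by a bijective one. *)
Definition unramified_galois (gT : finGroupType) (R : comNzRingType)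
    (S : comAlgType R) (A : algAction gT S) : Prop :=
  exists (tR : comNzRingType) (tS : comAlgType tR) (tA : algAction gT tS)
         (w : tR) (pR : {rmorphism tR -> R}) (pS : {rmorphism tS -> S}),
  [/\ is_dvr tR, is_dvr tS & is_galois tA] /\
  [/\ is_maximal (principal w) & is_maximal (principal (w%:A : tS))] /\
  [/\ forall (r : tR) (x : tS), pS (r *: x) = pR r *: pS x
    & forall (g : gT) (x : tS), pS (tA g x) = A g (pS x)] /\
  ((bijective pR /\ bijective pS) \/
   exists2 k : nat, (1 <= k)%N &
     [/\ forall r, exists r', pR r' = r,
         forall x, exists x', pS x' = x,
         forall r, pR r = 0 <-> r \in principal (w ^+ k)
       & forall x, pS x = 0 <-> x \in principal ((w ^+ k)%:A : tS)]).

(** * The skew group algebra *)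

(* [f : skew_group_alg A] is the sum of the f(g) g; [A] is a phantom parameter
   that determines the multiplication. *)
Definition skew_group_alg (gT : finGroupType) (R : comNzRingType)
  (S : comAlgType R) (A : algAction gT S) : Type := {ffun gT -> S}.

Section SkewGroupAlgebra.
Variables (gT : finGroupType) (R : comNzRingType) (S : comAlgType R).
Variable A : algAction gT S.
Local Notation SG := (skew_group_alg A).

HB.instance Definition _ := GRing.Zmodule.copy SG {ffun gT -> S}.

Definition skew_coef (f : SG) (g : gT) : S := (f : {ffun gT -> S}) g.

Definition skew_one : SG := [ffun g => (g == 1%g)%:R].

(* From (a g)(b h) = a g(b) (g h). *)
Definition skew_mul (f1 f2 : SG) : SG :=
  [ffun u => \sum_(g : gT) skew_coef f1 g * A g (skew_coef f2 (g^-1 * u)%g)].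

Lemma skew_mulA : associative skew_mul.
Proof.
move=> f1 f2 f3; apply/ffunP=> u; rewrite !ffunE.
under eq_bigr => g _.
  rewrite /skew_coef ffunE rmorph_sum mulr_sumr.
  rewrite (reindex_inj (mulgI g^-1%g)) /=.
  under eq_bigr => h _ do
    rewrite rmorphM mulrA /= -actME mulKVg invMg invgK mulgA mulgK.
  over.
rewrite exchange_big /=; apply: eq_bigr => h _.
by rewrite /skew_coef ffunE mulr_suml.
Qed.

Lemma skew_mul1l : left_id skew_one skew_mul.
Proof.
move=> f; apply/ffunP=> u; rewrite ffunE (bigD1 1%g) //= big1 => [|g g1].
  by rewrite /skew_coef ffunE eqxx mul1r act1E invg1 mul1g addr0.
by rewrite /skew_coef ffunE (negPf g1) mul0r.
Qed.

Lemma skew_mul1r : right_id skew_one skew_mul.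
Proof.
move=> f; apply/ffunP=> u; rewrite ffunE (bigD1 u) //= big1 => [|g gu].
  by rewrite /skew_coef ffunE mulVg eqxx rmorph1 mulr1 addr0.
rewrite /skew_coef ffunE -eq_mulVg1 (negPf gu).
by rewrite rmorph0 mulr0.
Qed.

Lemma skew_mulDl : left_distributive skew_mul +%R.
Proof.
move=> f1 f2 f3; apply/ffunP=> u; rewrite !ffunE -big_split.
by apply: eq_bigr => g _; rewrite /skew_coef ffunE mulrDl.
Qed.

Lemma skew_mulDr : right_distributive skew_mul +%R.
Proof.
move=> f1 f2 f3; apply/ffunP=> u; rewrite !ffunE -big_split.
by apply: eq_bigr => g _; rewrite /skew_coef ffunE rmorphD mulrDr.
Qed.

HB.instance Definition _ := GRing.Zmodule_isPzRing.Build SG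
  skew_mulA skew_mul1l skew_mul1r skew_mulDl skew_mulDr.

(* The identification of S[G] with End_R(S). *)
Definition skew_eval (f : SG) (x : S) : S :=
  \sum_(g : gT) skew_coef f g * A g x.

Lemma skew_evalM (f1 f2 : SG) x :
  skew_eval (f1 * f2) x = skew_eval f1 (skew_eval f2 x).
Proof.
rewrite /skew_eval.
transitivity (\sum_(u : gT) \sum_(g : gT)
   skew_coef f1 g * A g (skew_coef f2 (g^-1 * u)%g) * A u x).
  by apply: eq_bigr => u _; rewrite /skew_coef ffunE mulr_suml.
rewrite exchange_big; apply: eq_bigr => g _ /=.
rewrite rmorph_sum mulr_sumr (reindex_inj (mulgI g)) /=.
by apply: eq_bigr => h _; rewrite mulKg actME rmorphM mulrA.
Qed.

(* [<[s]>] is the whole group in the intended use, so that f is the sum of the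
   f(s^i) s^i for i < #[s]. *)
Definition sigma_deg (s : gT) (f : SG) : nat :=
  \max_(i < #[s]%g | skew_coef f (s ^+ i)%g != 0) i.

End SkewGroupAlgebra.

(** * Inner rank *)

Section InnerRank.
Variables (R : comNzRingType) (V : lmodType R).
Local Open Scope classical_set_scope.

Definition generated_by (m : nat) (M : set V) : Prop :=
  exists v : 'I_m -> V,
    M = [set x | exists c : 'I_m -> R, x = \sum_(i < m) c i *: v i].

(* The junk value 0 is taken when M is not a finitely generated submodule. *)
Definition rk_inn (M : set V) : nat :=
  match pselect (exists m, `[< generated_by m M >]) with
  | left fgM => ex_minn fgM
  | right _ => 0
  end.

End InnerRank.

Definition skew_rk_inn (gT : finGroupType) (R : comNzRingType)
    (S : comAlgType R) (A : algAction gT S) (f : skew_group_alg A) : nat :=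
  rk_inn (range (skew_eval f)).

(* Main.v *)
From HB Require Import structures.
Require Import Defs.
From mathcomp Require Import all_boot all_fingroup all_algebra.
From mathcomp Require Import generic_quotient boolp classical_sets.

Set Implicit Arguments.
Unset Strict Implicit.
Unset Printing Implicit Defensive.

Import GRing.Theory.
Local Open Scope ring_scope.

(** Write S~/R~ for the extension of discrete valuation rings lying over S/R,
and W for the common uniformizer. The inequality is proved modulo W, where it
is a statement about ranks over a field, but all computations are done with
determinants over S~ taken modulo the prime ideal (W).

Lift f to F with coefficients in S~ (zero where those of f vanish) and write
F = W^j h with h not divisible by W ([factor_power]; when S = S~ this uses that
the powers of (W) intersect in 0, [dvr_krull]). As W^j h does not vanish in S,
the kernel of S~ -> S lies in (W^(j+1)). Hence if m elements f(t_i) generate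
f(S) over R, cancelling W^j shows that modulo W each h(z) is an
R~-combination of the m elements h(t_i). Moreover the largest d such that the
coefficient of sigma^d in h is not in (W) is at most deg f.

The Galois property provides x_l, y_l in S~ with
sum_l v(x_l) u(y_l) = delta_(v,u) ([galois_dualE]). With these, the Dickson
matrix (g(h_(g^-1 u)))_(g,u) of h is the product of (g(h(x_l)))_(g,l) and
(u(y_l))_(l,u) ([galois_dual_dickson]); since h(x_l) is a combination of the
h(t_i) with G-invariant coefficients, the Dickson matrix factors modulo W
through a free module of rank m. On the other hand its minor with rows sigma^i
and columns sigma^(d+i), for i < n - d, is lower triangular modulo W with
diagonal entries sigma^i(h_d) outside the prime (W). So n - d <= m
([leq_rank_mod_prime]).

The inner rank has a junk value outside finitely generated modules, so one
also needs that S is finitely generated over R: the trace formula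
z = sum_l x_l tr(y_l z) shows that the x_l span ([galois_span]). *)

(** * Congruences modulo an ideal, and determinants *)

Section IdealCongruence.
Variables (T : comNzRingType) (I : {pred T}).
Hypothesis idI : idealr_closed I.

Lemma idealr_closed0 : 0 \in I.
Proof. by case: idI. Qed.

Lemma idealr_closedM a u : u \in I -> a * u \in I.
Proof. by case: idI => I0 _ h uI; rewrite -[a * u]addr0 h. Qed.

Lemma idealr_closedD u v : u \in I -> v \in I -> u + v \in I.
Proof. by case: idI => _ _ h uI vI; rewrite -[u]mul1r h. Qed.

Lemma idealr_closed_sum (J : Type) (r : seq J) (P : pred J) (F : J -> T) :
  (forall j, P j -> F j \in I) -> \sum_(j <- r | P j) F j \in I.
Proof.
move=> FI; elim/big_ind: _ => //; first exact: idealr_closed0.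
exact: idealr_closedD.
Qed.

Lemma prod_congr (J : Type) (r : seq J) (F F' : J -> T) :
  (forall j, F j - F' j \in I) ->
  \prod_(j <- r) F j - \prod_(j <- r) F' j \in I.
Proof.
move=> FF'; elim/big_rec2: _ => [|j a b _ abI].
  by rewrite subrr idealr_closed0.
have -> : F j * b - F' j * a = b * (F j - F' j) + F' j * (b - a).
  by rewrite mulrBr mulrBr [b * F j]mulrC [b * F' j]mulrC addrA subrK.
by apply: idealr_closedD; apply: idealr_closedM.
Qed.

Lemma det_congr k (M N : 'M[T]_k) :
  (forall i j, M i j - N i j \in I) -> \det M - \det N \in I.
Proof.
move=> MN; rewrite /determinant -sumrB; apply: idealr_closed_sum => s _.
by rewrite -mulrBr; apply/idealr_closedM/prod_congr => i.
Qed.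

Lemma prime_prod (J : finType) (F : J -> T) :
  prime_idealr_closed I -> (forall j, F j \notin I) -> \prod_j F j \notin I.
Proof.
move=> prI FI; elim/big_ind: _ => [|u v uI vI|j _]; last exact: FI.
  by case: idI.
by apply/negP => /prI; rewrite (negPf uI) (negPf vI).
Qed.

End IdealCongruence.

(** After padding both factors by zeros to square matrices, the first one has a
zero column. *)
Lemma det_mulmx_tall (T : comNzRingType) m k (P : 'M[T]_(k, m))
    (Q : 'M[T]_(m, k)) :
  (m < k)%N -> \det (P *m Q) = 0.
Proof.
move=> mk; move: P Q; rewrite -(subnKC mk) addSnnS => P Q.
have -> : P *m Q =
    row_mx P 0 *m col_mx Q (0 : 'M_((k - m.+1).+1, m + (k - m.+1).+1)).
  by rewrite mul_row_col mul0mx addr0.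
rewrite det_mulmx (expand_det_col _ (rshift m ord0)) big1 ?mul0r // => i _.
by rewrite row_mxEr mxE mul0r.
Qed.

(** * Dual elements of a Galois extension and the Dickson matrix *)

Section GaloisDual.
Variables (gT : finGroupType) (R : comNzRingType) (S : comAlgType R).
Variable A : algAction gT S.

(** The condition says that sum_l x_l (x) y_l is the separability idempotent:
the element of S (x)_R S that corresponds to the indicator function of 1. *)
Definition galois_dual q (x y : 'I_q -> S) : Prop :=
  forall g, \sum_(l < q) x l * A g (y l) = (g == 1%g)%:R.

Lemma galois_dual_exists :
  is_galois A -> exists q (x y : 'I_q -> S), galois_dual x y.
Proof.
case=> _ _ _ [k _ galK].
pose s := repr (k [ffun g => (g == 1%g)%:R]).
exists (size s), (fun l => (tnth (in_tuple s) l).1).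
exists (fun l => (tnth (in_tuple s) l).2) => g.
have /ffunP/(_ g) := galK [ffun g => (g == 1%g)%:R].
by rewrite !ffunE big_tnth => <-.
Qed.

Lemma skew_eval_linear (f : skew_group_alg A) : linear (skew_eval f).
Proof.
move=> a x y; rewrite /skew_eval scaler_sumr -big_split /=.
by apply: eq_bigr => g _; rewrite linearP mulrDr scalerAr.
Qed.

Variables (q : nat) (x y : 'I_q -> S).
Hypothesis xy : galois_dual x y.

Lemma galois_dualE (v u : gT) :
  \sum_(l < q) A v (x l) * A u (y l) = (v == u)%:R.
Proof.
have := congr1 (A v) (xy (v^-1 * u)%g).
rewrite rmorph_sum /= rmorph_nat -eq_mulVg1 => <-.
by apply: eq_bigr => l _; rewrite rmorphM /= -actME mulKVg.
Qed.

(** The matrix (A u (y l)) inverts (A v (x l)), so it recovers the coefficients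
of a skew polynomial from its values at the x l. *)
Lemma galois_dual_dickson (f : skew_group_alg A) (g u : gT) :
  \sum_(l < q) A g (skew_eval f (x l)) * A u (y l)
    = A g (skew_coef f (g^-1 * u)%g).
Proof.
transitivity (\sum_(v : gT) A g (skew_coef f v) * (g * v == u)%g%:R).
  under eq_bigr => l _ do rewrite rmorph_sum mulr_suml.
  rewrite exchange_big; apply: eq_bigr => v _ /=.
  rewrite -galois_dualE mulr_sumr; apply: eq_bigr => l _.
  by rewrite rmorphM /= -actME mulrA.
rewrite (bigD1 (g^-1 * u)%g) //= mulKVg eqxx mulr1 big1 ?addr0 // => v.
by move=> /negPf vN; rewrite -(inj_eq (mulgI g^-1%g)) mulKg vN mulr0.
Qed.

(** Exchanging the two sums, only the term of g = 1 survives. *)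
Lemma galois_dual_trace z : z = \sum_(l < q) x l * \sum_g A g (y l * z).
Proof.
under eq_bigr => l _ do rewrite mulr_sumr.
rewrite exchange_big (bigD1 1%g) //= [X in _ + X]big1 => [|g /negPf g1].
  rewrite addr0 -[LHS]mul1r.
  transitivity ((\sum_(l < q) x l * A 1%g (y l)) * z).
    by rewrite xy eqxx.
  by rewrite mulr_suml; apply: eq_bigr => l _; rewrite !act1E mulrA.
transitivity ((\sum_(l < q) x l * A g (y l)) * A g z).
  by rewrite mulr_suml; apply: eq_bigr => l _; rewrite rmorphM mulrA.
by rewrite xy g1 mul0r.
Qed.

(** The field case of the theorem in disguise: over the residue field at I, a
skew polynomial of degree d has rank at least #[sigma] - d. A minor of the
Dickson matrix of that size is triangular modulo I with determinant outside I,
and it also factors through m modulo I. *)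
Lemma leq_rank_mod_prime (sigma : gT) (I : {pred S}) (h : skew_group_alg A)
    (d m : nat) (t : 'I_m -> S) :
  idealr_closed I -> prime_idealr_closed I ->
  (forall g z, (A g z \in I) = (z \in I)) ->
  skew_coef h (sigma ^+ d)%g \notin I ->
  (forall i, (d < i < #[sigma]%g)%N -> skew_coef h (sigma ^+ i)%g \in I) ->
  (forall z, exists c : 'I_m -> R,
     skew_eval h z - \sum_(i < m) c i *: skew_eval h (t i) \in I) ->
  (#[sigma]%g - d <= m)%N.
Proof.
move=> idI prI stI hd hi /choice [c hc]; rewrite leqNgt; apply/negP => mk.
set k := (_ - d)%N in mk.
pose N := \matrix_(i < k, j < k)
  A (sigma ^+ i)%g (skew_coef h (sigma ^- i * sigma ^+ (d + j))%g).
pose P := \matrix_(i < k, l < m) A (sigma ^+ i)%g (skew_eval h (t l)).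
pose Q := \matrix_(l < m, j < k)
  \sum_(r < q) c (x r) l *: A (sigma ^+ (d + j))%g (y r).
pose L := \matrix_(i < k, j < k) if (i < j)%N then 0 else N i j.
have detN : \det N \in I.
  (* The coefficients c are in R, hence pass through the action of sigma. *)
  rewrite -[\det N]subr0 -(det_mulmx_tall P Q mk).
  apply: det_congr => // i j; rewrite !mxE -galois_dual_dickson.
  under [X in _ - X]eq_bigr => l _ do rewrite !mxE mulr_sumr.
  rewrite exchange_big -sumrB; apply: idealr_closed_sum => // r _ /=.
  under eq_bigr => l _ do rewrite -scalerAr scalerAl -linearZ.
  rewrite -mulr_suml -mulrBl -linear_sum -linearB mulrC.
  by apply: idealr_closedM => //=; rewrite stI.
have LN : \det L - \det N \in I.
  apply: det_congr => // i j; rewrite !mxE; case: ifP => ij; last first.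
    by rewrite subrr idealr_closed0.
  rewrite sub0r -mulN1r; apply: idealr_closedM => //; rewrite stI.
  have -> : (sigma ^- i * sigma ^+ (d + j) = sigma ^+ (d + (j - i)))%g.
    have -> : (d + j = i + (d + (j - i)))%N by rewrite addnCA subnKC // ltnW.
    by rewrite expgD mulKg.
  apply: hi; have := ltn_ord j; rewrite ltn_subRL => jk.
  rewrite -[X in (X < _)%N]addn0 ltn_add2l subn_gt0 ij /=.
  by apply: leq_ltn_trans jk; rewrite leq_add2l leq_subr.
have : \det L \in I by rewrite -(subrK (\det N) (\det L)) idealr_closedD.
apply/negP; rewrite det_trig; last first.
  by apply/is_trig_mxP => i j ij; rewrite !mxE ij.
apply: prime_prod => // i; rewrite !mxE ltnn stI.
by rewrite addnC expgD mulKg.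
Qed.

End GaloisDual.

(** * Maximal ideals and discrete valuation rings *)

Section PrincipalIdeals.
Variable T : comNzRingType.

Lemma principalP (w x : T) : reflect (exists y, x = y * w) (x \in principal w).
Proof. exact: asboolP. Qed.

(** The ideal I + (a) must be improper if a is not in I. *)
Lemma maximal_prime (I : {pred T}) : is_maximal I -> prime_idealr_closed I.
Proof.
move=> [idI maxI] a b abI; case: (boolP (a \in I)) => //= aI.
pose J : {pred T} :=
  [pred x | `[< exists2 y, y \in I & exists z, x = y + z * a >]].
have JP x : reflect (exists2 y, y \in I & exists z, x = y + z * a) (x \in J).
  exact: asboolP.
have aJ : a \in J.
  by apply/JP; exists 0; [exact: idealr_closed0 | exists 1; rewrite add0r mul1r].
have [/JP [y yI [z yz]]|nJ1] := boolP (1 \in J).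
  rewrite -[b]mul1r yz mulrDl mulrC -mulrA.
  by apply: idealr_closedD => //; apply: idealr_closedM.
case/negP: aI; rewrite -(maxI J) //; last first.
  by move=> y yI; apply/JP; exists y => //; exists 0; rewrite mul0r addr0.
split=> //; first by apply/JP; exists 0; [exact: idealr_closed0 | exists 0;
  rewrite mul0r addr0].
move=> c _ _ /JP [y yI [z ->]] /JP [y' yI' [z' ->]]; apply/JP.
exists (c * y + y'); first by apply: idealr_closedD => //; apply: idealr_closedM.
by exists (c * z + z'); rewrite mulrDr mulrDl -!mulrA addrACA.
Qed.

(** The definition excludes fields: the unique maximal ideal has a nonzero
element. *)
Lemma dvr_uniformizer_neq0 (w : T) :
  is_dvr T -> is_maximal (principal w) -> w != 0.
Proof.
move=> [_ _ [m [_ [x xm x0] mu]]] mw; apply: contraNneq x0 => w0.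
by have := xm; rewrite -(mu _ mw) w0 => /principalP [y ->]; rewrite mulr0.
Qed.

Lemma domain_mulIr (w x y : T) :
  GRing.integral_domain_axiom T -> w != 0 -> x * w = y * w -> x = y.
Proof.
move=> dom w0 /eqP; rewrite -subr_eq0 -mulrBl => /eqP /dom.
by rewrite (negPf w0) orbF subr_eq0 => /eqP.
Qed.

Lemma domain_expf_neq0 (w : T) k :
  GRing.integral_domain_axiom T -> w != 0 -> w ^+ k != 0.
Proof.
move=> dom w0; elim: k => [|k IH]; first by rewrite oner_neq0.
by apply/negP; rewrite exprS => /eqP /dom; rewrite (negPf w0) (negPf IH).
Qed.

(** Krull's intersection theorem for a principal ideal domain: the intersection
of the powers of (w) is some (b), and b = c w implies that c is in the
intersection too, so b = e w b, where e w <> 1. *)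
Lemma dvr_krull (w a : T) :
  is_dvr T -> is_maximal (principal w) -> a != 0 ->
  exists k, a \notin principal (w ^+ k).
Proof.
move=> dvrT mw; have w0 := dvr_uniformizer_neq0 dvrT mw.
have [dom pid _] := dvrT; have [[_ w1 _] _] := mw.
apply: contra_neqP => aN.
pose I : {pred T} := [pred x | `[< forall k, x \in principal (w ^+ k) >]].
have IP x : reflect (forall k, x \in principal (w ^+ k)) (x \in I).
  exact: asboolP.
have aI : a \in I by apply/IP => k; apply/negPn/negP => ak; apply: aN; exists k.
have [b Ib] : exists b, I =i principal b.
  apply: pid; split.
  - by apply/IP => k; apply/principalP; exists 0; rewrite mul0r.
  - by apply: contra w1 => /IP /(_ 1%N); rewrite expr1.
  move=> c u v /IP uI /IP vI; apply/IP => k; apply/principalP.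
  have /principalP [y ->] := uI k; have /principalP [z ->] := vI k.
  by exists (c * y + z); rewrite mulrDl mulrA.
have bI : b \in I by rewrite Ib; apply/principalP; exists 1; rewrite mul1r.
have /principalP [c bc] : b \in principal w by move/IP: bI => /(_ 1%N).
have : c \in I.
  apply/IP => k; have /IP/(_ k.+1) /principalP [d bd] := bI.
  apply/principalP; exists d; apply: (domain_mulIr dom w0).
  by rewrite -bc bd exprSr mulrA.
rewrite Ib => /principalP [e ce].
have /dom /orP [] : b * (1 - e * w) = 0.
- by rewrite mulrBr mulr1 {1}bc ce [e * b]mulrC mulrA subrr.
- by move: aI; rewrite Ib => /principalP [y ->] /eqP ->; rewrite mulr0.
rewrite subr_eq0 => /eqP ew; case/negP: w1; apply/principalP.
by exists e.
Qed.

(** Divides a family by the highest power of w common to its members. The strict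
bound j < k is what makes room for reducing modulo w after cancelling w ^+ j. *)
Lemma factor_power (J : finType) (w : T) (F : J -> T) k :
  (exists g, F g \notin principal (w ^+ k)) ->
  exists j (H : J -> T), [/\ (j < k)%N, forall g, F g = H g * w ^+ j
    & exists g, H g \notin principal w].
Proof.
move=> Fk.
have ex : exists k, [exists g, F g \notin principal (w ^+ k)].
  by exists k; apply/existsP.
case: (ex_minnP ex) => -[|j] /existsP [g gj] jmin.
  by case/negP: gj; apply/principalP; exists (F g); rewrite mulr1.
have jk : (j < k)%N by apply: jmin; apply/existsP.
have /choice [H FH] : forall g, exists y, F g = y * w ^+ j.
  move=> u; apply/principalP; apply: contraT => uj.
  by have := jmin j; rewrite ltnn; apply; apply/existsP; exists u.
exists j, H; split=> //; exists g; apply: contra gj => /principalP [y Hy].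
by apply/principalP; exists y; rewrite FH Hy exprS mulrA.
Qed.

End PrincipalIdeals.

(** * Finite generation and the inner rank *)

Section FiniteGeneration.
Variables (gT : finGroupType) (R : comNzRingType) (S : comAlgType R).
Variable A : algAction gT S.

HB.instance Definition _ (f : skew_group_alg A) :=
  GRing.isLinear.Build R S S _ (skew_eval f) (skew_eval_linear f).

Lemma generated_by_range (f : skew_group_alg A) q (z : 'I_q -> S) :
  (forall x, exists c : 'I_q -> R, x = \sum_(l < q) c l *: z l) ->
  generated_by q (range (skew_eval f)).
Proof.
move=> gen; exists (fun l => skew_eval f (z l)).
apply/seteqP; split=> [_ [x _ <-]|_ [c ->]] /=.
  have [c ->] := gen x; exists c.
  by rewrite linear_sum; apply: eq_bigr => l _; rewrite linearZ.
exists (\sum_(l < q) c l *: z l) => //.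
by rewrite linear_sum; apply: eq_bigr => l _; rewrite linearZ.
Qed.

Lemma generated_by_rk_inn (V : lmodType R) m (M : set V) :
  generated_by m M -> generated_by (rk_inn M) M.
Proof.
move=> Mm; rewrite /rk_inn; case: pselect => [ex|[]].
  by case: ex_minnP => r /asboolP.
by exists m; apply/asboolP.
Qed.

(** The coefficients in the trace formula are G-invariant, hence in R. *)
Lemma galois_span : is_galois A ->
  exists q (z : 'I_q -> S),
    forall x, exists c : 'I_q -> R, x = \sum_(l < q) c l *: z l.
Proof.
move=> galA; have [q [x [y xy]]] := galois_dual_exists galA.
exists q, x => z; have [_ _ fixA _] := galA.
have /choice [c cE] : forall l, exists r : R, \sum_g A g (y l * z) = r%:A.
  move=> l; apply: fixA => g; rewrite rmorph_sum /=.
  rewrite [RHS](reindex_inj (mulgI g)); apply: eq_bigr => u _.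
  by rewrite -actME.
exists c; rewrite [LHS](galois_dual_trace xy); apply: eq_bigr => l _.
by rewrite cE mulr_algr.
Qed.

End FiniteGeneration.

(** * The rank bound *)

Theorem proposition2p16 (gT : finGroupType) (sigma : gT) (n : nat)
    (R : comNzRingType) (S : comAlgType R) (A : algAction gT S)
    (G_cyclic : [set: gT] = <[sigma]>%g)
    (G_order : #|[set: gT]| = n)
    (SR_unramified : unramified_galois A)
    (f : skew_group_alg A) (f_neq0 : f != 0) :
  (n - sigma_deg sigma f <= skew_rk_inn f)%N.
Proof.
rewrite -G_order G_cyclic -/(order sigma).
have [tR [tS [tA [w [pR [pS [[_ dvrS galA] [[_ maxW] [[pZ pA] caseRS]]]]]]]]] :=
  SR_unramified.
set W := w%:A in maxW.
have [domS _ _] := dvrS; have [idW _] := maxW.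
have W0 := dvr_uniformizer_neq0 dvrS maxW.
have surjR r : exists r', pR r' = r.
  by case: caseRS => [[[k _ kK] _]|[k _ [//]]]; exists (k r).
have surjS x : exists x', pS x' = x.
  by case: caseRS => [[_ [k _ kK]]|[k _ [//]]]; exists (k x).
have /choice [F FE] : forall g, exists y,
    pS y = skew_coef f g /\ (skew_coef f g = 0 -> y = 0).
  move=> g; have [f0|f0] := eqVneq (skew_coef f g) 0.
    by exists 0; rewrite rmorph0.
  have [y yE] := surjS (skew_coef f g).
  by exists y; split=> // /eqP; rewrite (negPf f0).
have [g0 fg0] : exists g, skew_coef f g != 0.
  apply/existsP; apply: contraNT f_neq0 => /existsPn f0; apply/eqP/ffunP => g.
  by have := f0 g; rewrite negbK ffunE => /eqP.
(* In the quotient case k is the exponent of the kernel of pS; in the bijective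
   case any k large enough for F not to vanish modulo W ^+ k will do. *)
have [k [Fk kerk]] : exists k, (exists g, F g \notin principal (W ^+ k)) /\
    forall x, pS x = 0 -> x \in principal (W ^+ k).
  case: caseRS => [[_ bS]|[k _ [_ _ _ kerS]]].
    have [|k kF] := dvr_krull (a := F g0) dvrS maxW.
      by apply: contraNneq fg0 => F0; have [<- _] := FE g0; rewrite F0 rmorph0.
    exists k; split=> [|x]; first by exists g0.
    rewrite -(rmorph0 pS) => /(bij_inj bS) ->.
    by apply/principalP; exists 0; rewrite mul0r.
  have WE : W ^+ k = (w ^+ k)%:A by rewrite exprZn expr1n.
  exists k; rewrite WE; split=> [|x /kerS //]; exists g0.
  by apply: contra fg0 => /kerS; have [-> _] := FE g0 => ->.
have [j [H [jk FH Hn]]] := factor_power Fk.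
pose h : skew_group_alg tA := [ffun g => H g].
have hE g : skew_coef h g = H g by rewrite /skew_coef ffunE.
have fh z : skew_eval f (pS z) = pS (skew_eval h z * W ^+ j).
  rewrite /skew_eval mulr_suml rmorph_sum; apply: eq_bigr => g _.
  by rewrite hE mulrAC -FH rmorphM /= pA; have [-> _] := FE g.
(* Lets the relations between values of f descend to values of h modulo W. *)
have cancelW y : pS (y * W ^+ j) = 0 -> y \in principal W.
  move=> /kerk /principalP [z yz]; apply/principalP.
  exists (z * W ^+ (k - j.+1)).
  apply: (domain_mulIr domS (domain_expf_neq0 j domS W0)).
  by rewrite yz -!mulrA -exprS -exprD subnK.
have stW g z : (tA g z \in principal W) = (z \in principal W).
  have st u y : y \in principal W -> tA u y \in principal W.
    move=> /principalP [v ->]; apply/principalP; exists (tA u v).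
    by rewrite rmorphM /= /W linearZ rmorph1.
  apply/idP/idP => [/(st g^-1%g)|]; last exact: st.
  by rewrite -actME mulVg act1E.
have [g1 Hg1] := Hn.
have [i0 i0n g1E] : exists2 i, (i < #[sigma]%g)%N & g1 = (sigma ^+ i)%g.
  have /cyclePmin [i] : g1 \in <[sigma]>%g by rewrite -G_cyclic inE.
  by exists i.
pose Q (i : 'I_#[sigma]%g) := skew_coef h (sigma ^+ i)%g \notin principal W.
have Qi0 : Q (Ordinal i0n) by rewrite /Q hE /= -g1E.
case: (arg_maxnP (fun i : 'I__ => i : nat) Qi0) => d Qd dmax.
have d_le : (d <= sigma_deg sigma f)%N.
  apply: (leq_bigmax_cond (F := fun i : 'I__ => i : nat)).
  apply: contra Qd => /eqP fd; rewrite hE; apply: cancelW.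
  by have [FE1 /(_ fd) F0] := FE (sigma ^+ d)%g; rewrite -FH F0 rmorph0.
apply: leq_trans (leq_sub2l _ d_le) _.
have [q [z zgen]] := galois_span galA.
have /generated_by_rk_inn : generated_by q (range (skew_eval f)).
  apply: (@generated_by_range _ _ _ A f q (fun l => pS (z l))) => x.
  have [y <-] := surjS x; have [c ->] := zgen y; exists (fun l => pR (c l)).
  by rewrite rmorph_sum; apply: eq_bigr => l _; rewrite /= pZ.
rewrite -/(skew_rk_inn f); move: (skew_rk_inn f) => m [v vE].
have /choice [t tE] : forall i, exists y, v i = pS (skew_eval h y * W ^+ j).
  move=> i; have : range (skew_eval f) (v i).
    rewrite vE /=; exists (fun l => (l == i)%:R).
    rewrite (bigD1 i) //= eqxx scale1r big1 ?addr0 // => l /negPf ->.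
    by rewrite scale0r.
  by case=> x _ <-; have [y <-] := surjS x; exists y.
have [r [x [y xy]]] := galois_dual_exists galA.
apply: (leq_rank_mod_prime xy (h := h) (t := t) idW (maximal_prime maxW) stW Qd).
  move=> i /andP [di ilt]; apply: contraLR di => iN.
  by rewrite -leqNgt; apply: (dmax (Ordinal ilt)).
move=> u.
have [c cE] : exists c : 'I_m -> R, skew_eval f (pS u) = \sum_(i < m) c i *: v i.
  have : range (skew_eval f) (skew_eval f (pS u)) by exists (pS u).
  by rewrite vE.
have /choice [c' c'E] : forall i, exists a, pR a = c i by move=> i; apply: surjR.
exists c'; apply: cancelW; rewrite mulrBl rmorphB /= -fh cE mulr_suml rmorph_sum.
apply/eqP; rewrite subr_eq0; apply/eqP; apply: eq_bigr => i _.
by rewrite /= -scalerAl pZ c'E tE.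
Qed.
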